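(* Let $n\ge1$, let $E$ be a Polish space, let $X=(X_1,\dots,X_n)$ be a vector of independent $E$-valued random variables, and let $X'$ be an independent copy of $X$. Let $f:E^n\to\mathbb{R}$ be measurable with $\mathbf{E}[f(X)^2]<\infty$. Then $$ \mathbf{Var}(f(X))\ \ge\ \sum_{i=1}^n\mathbf{E}\left[\left(\mathbf{E}\left[\Delta_if(X',X)\mid X\right]\right)^2\right]. $$ In particular, if $X_1,\dots,X_n$ are i.i.d. with common distribution $\mu$ and $f$ is symmetric (invariant under permutations of its arguments), then $$ \mathbf{Var}(f(X))\ \ge\ n\int_E\left(\mathbf{E}\left[f(X)-f(x,X_2,\dots,X_n)\right]\right)^2\,\mu(dx). $$
   Context: For $y,y'\in E^n$ and $i\in\{1,\dots,n\}$, $\Delta_if(y,y')=f(y)-f(y_1,\dots,y_{i-1},y_i',y_{i+1},\dots,y_n)$. Hence $\Delta_if(X',X)=f(X')-f(X'_1,\dots,X'_{i-1},X_i,X'_{i+1},\dots,X'_n)$. *)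

(* Defs.v *)
From HB Require Import structures.
From mathcomp Require Import all_boot all_order all_algebra perm.
From mathcomp Require Import all_classical all_reals all_analysis.
From mathcomp Require Import measurable_realfun.
Import numFieldNormedType.Exports.

Set Implicit Arguments.
Unset Strict Implicit.
Unset Printing Implicit Defensive.

Import Order.TTheory GRing.Theory Num.Theory.

Local Open Scope classical_set_scope.
Local Open Scope ring_scope.

(* The metric is only asked to exist: being Polish is a property of the
   topology of [E]. *)
Definition completely_metrizable (R : realType) (E : topologicalType) : Prop :=
  exists dist : E -> E -> R,
    [/\ [/\ forall x y, 0 <= dist x y,
            forall x y, dist x y = 0 <-> x = y,
            forall x y, dist x y = dist y x
          & forall x y z, dist x z <= dist x y + dist y z],
        forall (x : E) (A : set E),
          nbhs x A <-> exists2 e : R, 0 < e & [set y | dist x y < e] `<=` A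
      & forall u : nat -> E,
          (forall e : R, 0 < e -> exists N : nat, forall m k : nat,
            (N <= m)%N -> (N <= k)%N -> dist (u m) (u k) < e) ->
          exists l : E, u @ \oo --> l].

Definition separable_space (E : topologicalType) : Prop :=
  exists2 D : set E, countable D & dense D.

Definition polish (R : realType) (E : topologicalType) : Prop :=
  completely_metrizable R E /\ separable_space E.

(* [E] with its Borel sigma-algebra.  Powers [n.-tuple (borel E)] carry the
   library's product sigma-algebra, which is the Borel sigma-algebra of [E^n]
   when [E] is second countable, in particular when [E] is Polish. *)
Notation borel E := (g_sigma_algebraType (@open E)).

Section random_vectors.
Context d (T : measurableType d) (R : realType) (P : probability T R).
Context d' (T' : measurableType d') (n : nat).

Definition component (X : {RV P >-> n.-tuple T'}) (i : 'I_n) : T -> T' :=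
  fun w => tnth (X w) i.

Lemma measurable_component (X : {RV P >-> n.-tuple T'}) (i : 'I_n) :
  measurable_fun [set: T] (component X i).
Proof. exact: measurableT_comp (measurable_tnth i) (measurable_funPT X). Qed.

HB.instance Definition _ (X : {RV P >-> n.-tuple T'}) (i : 'I_n) :=
  isMeasurableFun.Build _ _ _ _ (component X i) (measurable_component X i).

End random_vectors.

Section independence.
Context d (T : measurableType d) (R : realType) (P : probability T R).

Definition mutually_independent (I : finType) d' (T' : measurableType d')
    (Y : I -> {RV P >-> T'}) : Prop :=
  forall (J : {set I}) (B : I -> set T'),
    (forall i, i \in J -> measurable (B i)) ->
    P (\bigcap_(i in [set` J]) (Y i @^-1` B i)) =
    (\prod_(i in J) P (Y i @^-1` B i))%E.

Definition independent d1 d2 (T1 : measurableType d1) (T2 : measurableType d2)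
    (Y1 : {RV P >-> T1}) (Y2 : {RV P >-> T2}) : Prop :=
  forall (A : set T1) (B : set T2), measurable A -> measurable B ->
    P ((Y1 @^-1` A) `&` (Y2 @^-1` B)) =
    (P (Y1 @^-1` A) * P (Y2 @^-1` B))%E.

Definition has_law d' (T' : measurableType d') (Y : {RV P >-> T'})
    (mu : probability T' R) : Prop :=
  forall B : set T', measurable B -> distribution P Y B = mu B.

Definition independent_copy d' (T' : measurableType d')
    (Y' Y : {RV P >-> T'}) : Prop :=
  independent Y Y' /\ has_law Y' (distribution P Y).

End independence.

Section conditional_expectation.
Context d (T : measurableType d) (R : realType) (P : probability T R).
Context d' (T' : measurableType d') (X : {RV P >-> T'}).

(* [Y] is a version of [E[Z | sigma(X)]]. *)
Definition is_cond_expectation (Z Y : T -> R) : Prop :=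
  [/\ measurable_fun [set: g_sigma_algebra_preimageType X]
        (Y : g_sigma_algebra_preimageType X -> R),
      P.-integrable [set: T] (EFin \o Y)
    & forall A : set T, g_sigma_algebra_preimage X A ->
        (\int[P]_(w in A) (Y w)%:E = \int[P]_(w in A) (Z w)%:E)%E].

(* An arbitrary version of [E[Z | sigma(X)]]; by [cond_expectationP] below it
   is a genuine one whenever [Z] is integrable. *)
Definition cond_expectation (Z : T -> R) : T -> R :=
  xget (fun=> 0) [set Y | is_cond_expectation Z Y].

End conditional_expectation.

Section existence.
Local Open Scope ereal_scope.
Context d (T : measurableType d) (R : realType) (P : probability T R).
Context d' (T' : measurableType d') (X : {RV P >-> T'}).
Variable Z : T -> R.
Hypothesis intZ : P.-integrable [set: T] (EFin \o Z).

Let nu := induced_charge intZ.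

Let nuX (B : set T') := nu (X @^-1` B).

Let mX (B : set T') : measurable B -> measurable (X @^-1` B).
Proof. exact: measurable_funPTI. Qed.

Let nuX0 : nuX set0 = 0.
Proof. by rewrite /nuX preimage_set0; exact: (charge0 nu). Qed.

Let nuX_fin (B : set T') : measurable B -> nuX B \is a fin_num.
Proof. by move=> /mX mB; exact: (fin_num_measure nu). Qed.

Let nuX_sigma : semi_sigma_additive nuX.
Proof.
move=> F mF tF mUF; rewrite /nuX preimage_bigcup.
apply: (@charge_semi_sigma_additive _ _ _ nu).
- by move=> i; exact: mX.
- by apply/trivIsetP => i j _ _ ij; rewrite -preimage_setI;
    move/trivIsetP : tF => -> //; rewrite preimage_set0.
- by rewrite -preimage_bigcup; exact: mX.
Qed.

Let nuX_charge : {charge set T' -> \bar R} :=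
  HB.pack nuX (isCharge.Build _ T' R nuX nuX0 nuX_fin nuX_sigma).

Let nuX_dom : nuX_charge `<< distribution P X.
Proof.
apply/null_content_dominatesP => B mB PB.
apply: null_set_integral => //; first exact: mX.
by have /measurable_int := intZ; exact: measurable_funS.
Qed.

Lemma cond_expectation_exists : exists Y, is_cond_expectation X Z Y.
Proof.
pose g := Radon_Nikodym nuX_charge (distribution P X).
have gE : g = EFin \o (fine \o g).
  by apply/funext => x; rewrite /= fineK// Radon_Nikodym_fin_num.
have ig : (distribution P X).-integrable [set: T'] g.
  exact: Radon_Nikodym_integrable.
have mg : measurable_fun [set: T'] g by have /measurable_int := ig.
have igX : P.-integrable [set: T] (g \o X).
  apply/integrableP; split; first exact: measurableT_comp.
  move/integrableP : ig => [_]; apply: le_lt_trans.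
  by rewrite ge0_integral_distribution//; exact: measurableT_comp.
exists (fine \o g \o X); split.
- move=> _ B mB; rewrite setTI; exists ((fine \o g) @^-1` B); last first.
    by rewrite setTI.
  rewrite -[X in measurable X]setTI.
  have : measurable_fun [set: T'] (fine \o g) by exact: measurableT_comp.
  by apply.
- by move: igX; rewrite gE.
- move=> _ [B mB <-]; rewrite setTI.
  transitivity (nuX_charge B); last by [].
  rewrite (Radon_Nikodym_integral nuX_dom)// -/g.
  rewrite integral_pushforward//.
    by apply: eq_integral => w _; rewrite [in RHS]gE.
  by apply: (integrableS _ _ _ igX) => //; exact: mX.
Qed.

Lemma cond_expectationP : is_cond_expectation X Z (cond_expectation X Z).
Proof. exact: (xgetPex (fun=> 0%R) cond_expectation_exists). Qed.

End existence.

Section difference_operator.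
Context (E : Type) (R : realType) (n : nat).

Definition subst_at (y : n.-tuple E) (i : 'I_n) (x : E) : n.-tuple E :=
  [tuple if j == i then x else tnth y j | j < n].

Definition Delta (f : n.-tuple E -> R) (i : 'I_n) (y y' : n.-tuple E) : R :=
  f y - f (subst_at y i (tnth y' i)).

Definition symmetric_fun (f : n.-tuple E -> R) : Prop :=
  forall (s : 'S_n) (y : n.-tuple E), f [tuple tnth y (s j) | j < n] = f y.

End difference_operator.

(* Main.v *)
Require Import Defs.
From HB Require Import structures.
From mathcomp Require Import all_boot all_order all_algebra perm.
From mathcomp Require Import all_classical all_reals all_analysis.
From mathcomp Require Import measurable_realfun.
Import numFieldNormedType.Exports.
Import Order.TTheory GRing.Theory Num.Theory.
Local Open Scope classical_set_scope.
Local Open Scope ring_scope.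

Set Implicit Arguments.
Unset Strict Implicit.
Unset Printing Implicit Defensive.

(** Let [nu] be the law of [X] and, for each [i], let [S i (y, y')] be [y'] with
    its [i]-th coordinate replaced by that of [y]; independence says that [S i]
    maps [nu \x nu] to [nu].  Put [K i y = \int f (S i (y, y')) nu(dy')], which
    depends only on the [i]-th coordinate.  By Fubini, integrating [g] against a
    function of the [i]-th coordinate is the same as integrating its average
    over the other coordinates, hence [cov(f, K i) = Var(K i)] and
    [cov(K i, K j) = 0] for [i != j], and Bessel's inequality gives
    [\sum_i Var(K i) <= Var(f)].  Finally [E[Delta f i X' X | X]] is the centred
    variable [E[f] - K i (X)], and in the i.i.d. symmetric case [Var(K i)] does
    not depend on [i]. *)

(** * Change of variables along a map that carries [mu] to [nu] *)

Section transfer.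
Context d1 d2 (T1 : measurableType d1) (T2 : measurableType d2) (R : realType).
Variables (mu : {measure set T1 -> \bar R}) (nu : {measure set T2 -> \bar R}).
Variables (phi : T1 -> T2) (mphi : measurable_fun [set: T1] phi).
Hypothesis nuE : forall A, measurable A -> mu (phi @^-1` A) = nu A.
Local Open Scope ereal_scope.

Lemma ge0_integral_law (D : set T2) (h : T2 -> \bar R) : measurable D ->
  measurable_fun [set: T2] h -> (forall y, 0 <= h y) ->
  \int[nu]_(y in D) h y = \int[mu]_(x in phi @^-1` D) h (phi x).
Proof.
move=> mD mh h0; rewrite -[RHS](@ge0_integral_pushforward _ _ _ _ _ _ mphi)//.
- by apply: eq_measure_integral => A mA _; rewrite -nuE.
- exact: measurable_funTS.
Qed.

(** Each side is by definition the integral of the positive part minus that of the negative part,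
    and taking these parts commutes with composition by [phi]. *)
Lemma integral_law (D : set T2) (h : T2 -> \bar R) : measurable D ->
  measurable_fun [set: T2] h ->
  \int[nu]_(y in D) h y = \int[mu]_(x in phi @^-1` D) h (phi x).
Proof.
move=> mD mh; rewrite integralE [RHS]integralE.
under [X in _ = X - _]eq_integral do rewrite (funepos_comp h phi)/=.
under [X in _ = _ - X]eq_integral do rewrite (funeneg_comp h phi)/=.
congr (_ - _).
- exact: ge0_integral_law mD (measurable_funepos mh) (funepos_ge0 h).
- exact: ge0_integral_law mD (measurable_funeneg mh) (funeneg_ge0 h).
Qed.

Lemma integrable_law (h : T2 -> \bar R) : measurable_fun [set: T2] h ->
  nu.-integrable [set: T2] h <-> mu.-integrable [set: T1] (h \o phi).
Proof.
move=> mh; have E : \int[nu]_y `|h y| = \int[mu]_x `|h (phi x)|.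
  by rewrite (ge0_integral_law measurableT (h := fun y => `|h y|))//;
    exact: measurableT_comp.
split=> /integrableP[_ fin]; apply/integrableP; split => //.
- exact: measurableT_comp.
- by rewrite -E.
- by rewrite E.
Qed.

End transfer.

(** * Square-integrable functions: Jensen, covariance, Bessel *)

Section square_integrable.
Context d (T : measurableType d) (R : realType).
Local Open Scope ereal_scope.

Lemma Lfun2P (mu : {measure set T -> \bar R}) (g : T -> R) :
  g \in Lfun mu 2%:E <->
  measurable_fun [set: T] g /\ \int[mu]_x (g x ^+ 2)%:E < +oo.
Proof.
split=> [g2|[mg g2]].
  split; first by move: g2; rewrite inE => /andP[/[!inE]].
  have /integrableP[_] := Lfun2_integrable_sqr g2; apply: le_lt_trans.
  rewrite le_eqVlt; apply/orP; left; apply/eqP; apply: eq_integral => x _ /=.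
  by rewrite ger0_norm// sqr_ge0.
rewrite inE; apply/andP; split; rewrite inE//= /finite_norm unlock /Lnorm.
rewrite poweR_lty//; apply: le_lt_trans g2.
rewrite le_eqVlt; apply/orP; left; apply/eqP; apply: eq_integral => x _ /=.
by rewrite powR_mulrn// real_normK// num_real.
Qed.

Variable P : probability T R.

Lemma Lfun2_Lfun1 (g : T -> R) : g \in Lfun P 2%:E -> g \in Lfun P 1.
Proof. by apply: Lfun_subset12; exact: fin_num_measure. Qed.

Lemma Lfun2_integrable (g : T -> R) :
  g \in Lfun P 2%:E -> P.-integrable [set: T] (EFin \o g).
Proof. by move=> g2; apply/Lfun1_integrable; exact: Lfun2_Lfun1. Qed.

(** For [g] in L2 this is the nonnegativity of the variance; for any other measurable [g] the
    right-hand side is infinite. *)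
Lemma sqr_expectation_le (g : T -> R) : measurable_fun [set: T] g ->
  ((fine 'E_P[g]) ^+ 2)%:E <= 'E_P[g ^+ 2].
Proof.
move=> mg; have [g2|] := boolP (g \in Lfun P 2%:E); last first.
  move=> /negP g2; suff -> : 'E_P[g ^+ 2] = +oo by rewrite leey.
  apply/eqP; rewrite -leye_eq leNgt; apply/negP => goo; apply: g2.
  by apply/Lfun2P; split => //; move: goo; rewrite unlock.
have := variance_ge0 P g; rewrite varianceE// sube_ge0; last first.
  by rewrite fin_numX// expectation_fin_num// Lfun2_Lfun1.
by rewrite EFin_expe fineK// expectation_fin_num// Lfun2_Lfun1.
Qed.

Lemma covariance_sumr n (g : T -> R) (k : 'I_n -> T -> R) :
  g \in Lfun P 2%:E -> (forall i, k i \in Lfun P 2%:E) ->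
  covariance P g (\sum_i k i)%R = \sum_i covariance P g (k i).
Proof.
move=> g2 k2.
(* Additivity of the covariance asks that partial sums lie in L2, so the induction carries this
   membership along. *)
suff [] : (\sum_i k i)%R \in Lfun P 2%:E /\
  covariance P g (\sum_i k i)%R = \sum_i covariance P g (k i) by [].
apply: (big_ind2 (fun a b => a \in Lfun P 2%:E /\ covariance P g a = b)).
- by split; [by rewrite rpred0// lee1n|exact: (covariance_cst_r P g 0)].
- move=> a _ b _ [a2 <-] [b2 <-]; split; first by rewrite rpredD// lee1n.
  exact: covarianceDr.
- by [].
Qed.

(* Bessel's inequality for the centred functions [k i - E[k i]]; the
   hypothesis [cov g (k i) = V (k i)] says that [k i - E[k i]] is the projection
   of [g] onto its line. *)
Lemma variance_ge_sum n (g : T -> R) (k : 'I_n -> T -> R) :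
  g \in Lfun P 2%:E -> (forall i, k i \in Lfun P 2%:E) ->
  (forall i, covariance P g (k i) = 'V_P[k i]) ->
  (forall i j, i != j -> covariance P (k i) (k j) = 0) ->
  \sum_i 'V_P[k i] <= 'V_P[g].
Proof.
move=> g2 k2 gk kk; set S := (\sum_i k i)%R.
have S2 : S \in Lfun P 2%:E by rewrite rpred_sum// lee1n.
have gS : covariance P g S = \sum_i 'V_P[k i].
  by rewrite covariance_sumr//; apply: eq_bigr.
have VS : 'V_P[S] = \sum_i 'V_P[k i].
  rewrite /variance covariance_sumr//; apply: eq_bigr => i _.
  rewrite covarianceC covariance_sumr// (bigD1 i)//= big1 ?adde0// => j ji.
  by rewrite kk// eq_sym.
have := variance_ge0 P (g \- S)%R; rewrite varianceB// VS gS.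
have Sfin : \sum_i 'V_P[k i] \is a fin_num by rewrite -VS variance_fin_num.
rewrite -(fineK Sfin) -(fineK (variance_fin_num g2)).
rewrite -EFinM -!EFinD !lee_fin mulr_natl mulr2n opprD addrA addrK.
by rewrite subr_ge0.
Qed.

End square_integrable.

(** * Boxes and measures on a finite power *)

Section tuple_law.
Context d (T : measurableType d) (n : nat) (R : realType).
Local Open Scope ereal_scope.

Definition box (B : 'I_n -> set T) : set (n.-tuple T) :=
  [set y | forall i, B i (tnth y i)].

(** The intersection over the full index set is the shape of event that [mutually_independent]
    speaks about. *)
Lemma boxE (B : 'I_n -> set T) :
  box B = \bigcap_(i in [set` [set: 'I_n]%SET]) ((@tnth n T)^~ i @^-1` B i).
Proof.
apply/seteqP; split=> y By i /=; first by move=> _; exact: By.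
by apply: By => /=; rewrite finset.inE.
Qed.

Lemma measurable_box (B : 'I_n -> set T) :
  (forall i, measurable (B i)) -> measurable (box B).
Proof.
move=> mB; rewrite boxE; apply: fin_bigcap_measurable => // i _.
by rewrite -[X in measurable X]setTI; exact: measurable_tnth.
Qed.

(** Boxes are stable under intersection, contain the whole space and generate the product
    sigma-algebra, so a finite measure is determined by its values on them. *)
Lemma tuple_measure_unique (m1 m2 : {measure set (n.-tuple T) -> \bar R}) :
  m1 [set: _] < +oo ->
  (forall B, (forall i, measurable (B i)) -> m1 (box B) = m2 (box B)) ->
  forall A, measurable A -> m1 A = m2 A.
Proof.
move=> m1oo m12; pose G := [set A | exists2 B : 'I_n -> set T,
  forall i, measurable (B i) & A = box B].
have GT : G [set: _] by exists (fun=> setT) => //; apply/seteqP; split.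
apply: (measure_unique G (fun=> setT)) => //.
- apply/seteqP; split; last first.
    apply: smallest_sub; first exact: sigma_algebra_measurable.
    by move=> _ [B mB ->]; exact: measurable_box.
  apply: sub_smallest2r; first exact: smallest_sigma_algebra.
  rewrite -bigcup_seq => _ [i _ [C mC <-]]; rewrite setTI.
  (* A generator of the product sigma-algebra constrains a single coordinate; it is the box whose
     other sides are full. *)
  exists (fun j => if j == i then C else setT).
    by move=> j; case: ifP.
  apply/seteqP; split=> [y Cy j /=|y /(_ i)/=]; last by rewrite eqxx.
  by case: eqP => [->|].
- move=> _ _ [B mB ->] [C mC ->]; exists (fun i => B i `&` C i).
    by move=> i; exact: measurableI.
  by apply/seteqP; split=> [y [By Cy] i|y BCy /=];
    [by split; [exact: By|exact: Cy]|split=> i; have [] := BCy i].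
- by rewrite bigcup_const.
- by move=> _ [B mB ->]; exact: m12.
Qed.

Lemma measurable_subst_at d' (T' : measurableType d') (i : 'I_n)
    (u : T' -> n.-tuple T) (v : T' -> T) :
  measurable_fun [set: T'] u -> measurable_fun [set: T'] v ->
  measurable_fun [set: T'] (fun z => subst_at (u z) i (v z)).
Proof.
move=> mu mv; apply/measurable_fun_tnthP => j.
rewrite (_ : _ \o _ = fun z => if j == i then v z else tnth (u z) j); last first.
  by apply/funext => z; rewrite /= tnth_mktuple.
case: (j == i) => //.
exact: (measurableT_comp (measurable_tnth j) mu).
Qed.

Lemma measurable_permute (s : 'S_n) : measurable_fun [set: n.-tuple T]
  (fun y : n.-tuple T => [tuple tnth y (s j) | j < n] : n.-tuple T).
Proof.
apply/measurable_fun_tnthP => j.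
rewrite (_ : _ \o _ = fun y => tnth y (s j)); first exact: measurable_tnth.
by apply/funext => z; rewrite /= tnth_mktuple.
Qed.

End tuple_law.

(** * Replacement of one coordinate *)

Section subst_at.
Context (E : Type) (n : nat).
Implicit Types (x : E) (y z : n.-tuple E) (i j : 'I_n).

Lemma tnth_subst_at y i x : tnth (subst_at y i x) i = x.
Proof. by rewrite tnth_mktuple eqxx. Qed.

Lemma tnth_subst_at_neq y i x j : j != i ->
  tnth (subst_at y i x) j = tnth y j.
Proof. by move=> /negPf ji; rewrite tnth_mktuple ji. Qed.

(** Transposing [i] and [j] moves the replaced entry from place [j] to place [i]; this is what makes
    all coordinates equivalent for symmetric [f]. *)
Lemma subst_at_tperm y i j x :
  [tuple tnth (subst_at y j x) (tperm i j k) | k < n] =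
  subst_at [tuple tnth y (tperm i j k) | k < n] i x.
Proof.
apply: eq_from_tnth => k; rewrite !tnth_mktuple.
by rewrite -[X in _ == X](tpermL i j) (inj_eq perm_inj).
Qed.

End subst_at.

(** * The law of a vector with independent components *)

Section independent_components.
Context d (T : measurableType d) (R : realType) (P : probability T R).
Context d' (T' : measurableType d') (n : nat).
Variable X : {RV P >-> n.-tuple T'}.
Hypothesis indepX : mutually_independent
  (fun i => component X i : {RV P >-> T'}).
Local Open Scope ereal_scope.

Lemma distribution_box (B : 'I_n -> set T') :
  (forall i, measurable (B i)) ->
  distribution P X (box B) = \prod_i P (component X i @^-1` B i).
Proof.
move=> mB; rewrite boxE /distribution /pushforward preimage_bigcap.
rewrite (indepX (J := [set: 'I_n]%SET))//.
by apply: eq_bigl => i; rewrite finset.inE.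
Qed.

(** It suffices to compare both measures on boxes. There the preimage is a rectangle, and
    independence factorises its two sides into the factors of the box. *)
Lemma distribution_subst_at (i : 'I_n) (A : set (n.-tuple T')) : measurable A ->
  (distribution P X \x distribution P X)
    ((fun z : n.-tuple T' * n.-tuple T' =>
        subst_at z.2 i (tnth z.1 i)) @^-1` A) = distribution P X A.
Proof.
move=> mA; set S := (fun z => _).
have mS : measurable_fun [set: n.-tuple T' * n.-tuple T'] S.
  apply: measurable_subst_at => //.
  exact: (measurableT_comp (measurable_tnth i)).
pose Smfun : {mfun _ >-> _} := HB.pack S (isMeasurableFun.Build _ _ _ _ S mS).
rewrite -[LHS]/(pushforward _ Smfun A).
apply: tuple_measure_unique mA => [|B mB].
  rewrite /= /pushforward preimage_setT -setXTT product_measure1E//.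
  rewrite -[X in X < _]/(distribution P X setT * distribution P X setT).
  by rewrite probability_setT mule1 ltry.
rewrite /= /pushforward.
(* Coordinate [i] is taken from the first vector, so the second vector is left free there. *)
pose B' j := if j == i then setT else B j.
have -> : S @^-1` box B = ((@tnth n T')^~ i @^-1` B i) `*` box B'.
  apply/seteqP; split=> -[y y'] /=.
    move=> By; split; first by have := By i; rewrite tnth_subst_at.
    move=> j; rewrite /B'; case: eqVneq => // ji.
    by have := By j; rewrite tnth_subst_at_neq.
  move=> [Bi By'] j; rewrite /S/= tnth_mktuple; case: eqVneq => [->//|ji].
  by have := By' j; rewrite /B' (negPf ji).
have mB' j : measurable (B' j) by rewrite /B'; case: ifP.
rewrite product_measure1E//; last exact: measurable_box.
  rewrite -[LHS]/(distribution P X ((@tnth n T')^~ i @^-1` B i) *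
    distribution P X (box B')).
  rewrite !distribution_box// (bigD1 i)//= [in RHS](bigD1 i)//=.
  have -> : B' i = setT by rewrite /B' eqxx.
  rewrite preimage_setT probability_setT mul1e; congr (_ * _).
  by apply: eq_bigr => j ji; rewrite /B' (negPf ji).
by rewrite -[X in measurable X]setTI; exact: measurable_tnth.
Qed.

(** On a box both sides are the product of the numbers [mu (B j)], in two different orders. *)
Lemma distribution_permute (mu : probability T' R) (s : 'S_n)
    (A : set (n.-tuple T')) :
  (forall i, has_law (component X i : {RV P >-> T'}) mu) -> measurable A ->
  distribution P X
    ((fun y : n.-tuple T' => [tuple tnth y (s j) | j < n]) @^-1` A) =
  distribution P X A.
Proof.
move=> Xmu mA; set S := (fun y => _).
have mS : measurable_fun [set: n.-tuple T'] S by exact: measurable_permute.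
pose Smfun : {mfun _ >-> _} := HB.pack S (isMeasurableFun.Build _ _ _ _ S mS).
rewrite -[LHS]/(pushforward _ Smfun A).
apply: tuple_measure_unique mA => [|B mB].
  by rewrite /= /pushforward preimage_setT probability_setT ltry.
rewrite /= {1}/pushforward.
have -> : S @^-1` box B = box (fun j => B ((s^-1)%g j)).
  apply/seteqP; split=> y By j.
    by have := By ((s^-1)%g j); rewrite tnth_mktuple permKV.
  by rewrite tnth_mktuple; have := By (s j); rewrite permK.
have XE i C : measurable C -> P (component X i @^-1` C) = mu C := Xmu i C.
rewrite !distribution_box// (reindex_inj (@perm_inj _ s))/=.
by apply: eq_bigr => j _; rewrite permK !XE.
Qed.

End independent_components.

(** Tonelli applies to the positive and the negative part separately, and the difference of the two
    results is measurable. *)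
Lemma measurable_integral_snd d1 d2 (T1 : measurableType d1)
    (T2 : measurableType d2) (R : realType)
    (m2 : {sigma_finite_measure set T2 -> \bar R}) (h : T1 * T2 -> \bar R) :
  measurable_fun [set: T1 * T2] h ->
  measurable_fun [set: T1] (fun x => \int[m2]_y h (x, y))%E.
Proof.
move=> mh; rewrite (_ : (fun x => _) = fun x =>
  (\int[m2]_y h^\+ (x, y) - \int[m2]_y h^\- (x, y))%E); last first.
  apply/funext => x; rewrite integralE.
  under eq_integral do rewrite (funepos_comp h (pair x))/=.
  by under [X in (_ - X)%E = _]eq_integral
    do rewrite (funeneg_comp h (pair x))/=.
apply: emeasurable_funB.
- apply: (measurable_fun_fubini_tonelli_F h^\+%E) => //.
  exact: measurable_funepos.
- apply: (measurable_fun_fubini_tonelli_F h^\-%E) => //.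
  exact: measurable_funeneg.
Qed.

(** * Averaging with one coordinate kept, in abstract form *)

Section resampling.
Context d (T : measurableType d) (R : realType) (nu : probability T R).
Context (n : nat) (S : 'I_n -> T * T -> T).
Hypothesis mS : forall i, measurable_fun [set: T * T] (S i).
Hypothesis nuS : forall i A, measurable A ->
  (nu \x nu)%E (S i @^-1` A) = nu A.
(** [S_same] and [S_other] express, without naming coordinates, that [S i (y, y')] shares coordinate
    [i] with [y] and the others with [y']. *)
Hypothesis S_same : forall i y y' z, S i (S i (y, y'), z) = S i (y, z).
Hypothesis S_other : forall i j y y' z, i != j ->
  S j (S i (y, y'), z) = S j (y', z).
Local Open Scope ereal_scope.

(** A version of the conditional expectation of [g] given coordinate [i]. For integrable [g] the
    inner expectation is finite for almost every [y]; elsewhere [fine] may return its default 0. *)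
Definition resample (i : 'I_n) (g : T -> R) (y : T) : R :=
  fine 'E_nu[fun y' => g (S i (y, y'))].

Let measurable_gS i (g : T -> R) : measurable_fun [set: T] g ->
  measurable_fun [set: T * T] (fun z => (g (S i z))%:E).
Proof. by move=> mg; apply/measurable_EFinP; exact: measurableT_comp. Qed.

Let Lfun2_measurable (g : T -> R) :
  g \in Lfun nu 2%:E -> measurable_fun [set: T] g.
Proof. by move/Lfun2P => []. Qed.

Lemma measurable_resample i (g : T -> R) : measurable_fun [set: T] g ->
  measurable_fun [set: T] (resample i g).
Proof.
move=> mg; rewrite /resample unlock.
apply: (measurableT_comp (fine_measurable measurableT)).
exact: measurable_integral_snd (measurable_gS i mg).
Qed.

(** Jensen for fixed [y], then Tonelli: the second moment of the average is at most that of
    [g \o S i] under [nu \x nu], which is that of [g] under [nu]. *)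
Lemma resample_Lfun2 i (g : T -> R) : g \in Lfun nu 2%:E ->
  resample i g \in Lfun nu 2%:E.
Proof.
move=> /Lfun2P[mg g2]; apply/Lfun2P; split; first exact: measurable_resample.
have mg2 : measurable_fun [set: T] (fun y => (g y ^+ 2)%:E).
  by apply/measurable_EFinP; exact: measurable_funX.
move: g2; rewrite (ge0_integral_law (mS i) (nuS i))//; last first.
  by move=> y; rewrite lee_fin sqr_ge0.
rewrite preimage_setT fubini_tonelli1//=; last 2 first.
- exact: (measurableT_comp mg2 (mS i)).
- by move=> z; rewrite lee_fin sqr_ge0.
apply: le_lt_trans; apply: ge0_le_integral => //.
- by move=> y _; rewrite lee_fin sqr_ge0.
- apply/measurable_EFinP; apply: measurable_funX.
  exact: measurable_resample.
- apply: measurable_integral_snd.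
  exact: (measurableT_comp mg2 (mS i)).
- move=> y _; have mgy : measurable_fun [set: T] (fun y' => g (S i (y, y'))).
    apply: measurableT_comp => //.
    exact: (measurableT_comp (mS i) (pair1_measurable y)).
  by have := sqr_expectation_le nu mgy; rewrite /resample [in leRHS]unlock.
Qed.

Lemma resample_integrable i (g : T -> R) : nu.-integrable [set: T] (EFin \o g) ->
  {ae nu, forall y,
    nu.-integrable [set: T] (fun y' => (g (S i (y, y')))%:E)}.
Proof.
move=> ig; apply: (@ae_integrable1 _ _ _ _ _ nu nu (fun z => (g (S i z))%:E)).
have mg : measurable_fun [set: T] (EFin \o g) := measurable_int _ ig.
by apply/(integrable_law (mS i) (nuS i) mg).
Qed.

(** The defining property of conditional expectation: the hypothesis on [k] says that it depends on
    coordinate [i] only. The proof pulls [g \* k] back along [S i] and applies Fubini. *)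
Lemma expectation_resampleM i (g k : T -> R) :
  g \in Lfun nu 2%:E -> k \in Lfun nu 2%:E ->
  (forall y y', k (S i (y, y')) = k y) ->
  'E_nu[resample i g \* k] = 'E_nu[g \* k].
Proof.
move=> g2 k2 kS; have mg := Lfun2_measurable g2.
have mk := Lfun2_measurable k2.
have igk : nu.-integrable [set: T] (EFin \o (g \* k)%R).
  exact/Lfun1_integrable/Lfun2_mul_Lfun1.
have mgk : measurable_fun [set: T] (EFin \o (g \* k)%R) := measurable_int _ igk.
have := igk; rewrite (integrable_law (mS i) (nuS i) mgk) => igkS.
rewrite unlock [RHS](integral_law (mS i) (nuS i) measurableT mgk)//.
rewrite preimage_setT -(integral12_prod_meas1 igkS).
apply: ae_eq_integral => //.
- apply/measurable_EFinP; apply: measurable_funM => //.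
  exact: measurable_resample.
- exact: measurable_integral_snd (measurable_int _ igkS).
(* Where the section of [g] is integrable, [fine] loses nothing and the constant [k y] moves under
   the integral, where it is [k (S i (y, y'))]. *)
- have := resample_integrable i (Lfun2_integrable g2).
  apply: filterS => y igy _ /=.
  rewrite /fubini_F/= /resample unlock EFinM fineK; last first.
    exact: integrable_fin_num.
  rewrite -integralZr//; apply: eq_integral => y' _.
  by rewrite kS EFinM.
Qed.

Lemma expectation_resample i (g : T -> R) : g \in Lfun nu 2%:E ->
  'E_nu[resample i g] = 'E_nu[g].
Proof.
move=> g2; have := expectation_resampleM g2 (Lfun_cst nu 1%R 2%R)
  (fun _ _ => erefl).
move=> /(_ i); rewrite (_ : resample i g \* _ = resample i g)%R; last first.
  by apply/funext => y /=; rewrite mulr1.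
rewrite (_ : g \* _ = g)%R//.
by apply/funext => y /=; rewrite mulr1.
Qed.

Lemma covariance_resample i (g k : T -> R) :
  g \in Lfun nu 2%:E -> k \in Lfun nu 2%:E ->
  (forall y y', k (S i (y, y')) = k y) ->
  covariance nu g k = covariance nu (resample i g) k.
Proof.
move=> g2 k2 kS; have rg2 := resample_Lfun2 i g2.
rewrite !covarianceE ?Lfun2_mul_Lfun1 ?Lfun2_Lfun1//.
rewrite expectation_resample// -[(_ * _)%R]/(_ \* _)%R.
by rewrite -(expectation_resampleM g2 k2 kS).
Qed.

Lemma sum_variance_resample_le (f : T -> R) : f \in Lfun nu 2%:E ->
  \sum_i 'V_nu[resample i f] <= 'V_nu[f].
Proof.
move=> f2; have rf2 i := resample_Lfun2 i f2.
have same i y y' : resample i f (S i (y, y')) = resample i f y.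
  rewrite /resample; congr (fine 'E_nu[_]).
  by apply/funext => z; rewrite S_same.
apply: variance_ge_sum => // [i|i j ij].
  exact: covariance_resample.
have other y y' : resample j f (S i (y, y')) = resample j f y'.
  rewrite /resample; congr (fine 'E_nu[_]).
  by apply/funext => z; rewrite S_other.
(* Since [resample j f] ignores coordinate [i], averaging it with only that coordinate kept gives a
   constant, whose covariance with anything vanishes. *)
rewrite covarianceC (covariance_resample _ _ (same i))//.
rewrite (_ : resample i (resample j f) = cst (fine 'E_nu[resample j f])).
  exact: covariance_cst_l.
apply/funext => y; rewrite {1}/resample; congr (fine 'E_nu[_]).
by apply/funext => y'; exact: other.
Qed.

(** Only almost everywhere: splitting the integral of the difference requires the section of [f] at
    [y] to be integrable. *)
Lemma resample_centered i (f : T -> R) : f \in Lfun nu 2%:E ->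
  {ae nu, forall y, \int[nu]_y' (f y' - f (S i (y, y')))%:E =
                    (fine 'E_nu[f] - resample i f y)%:E}.
Proof.
move=> f2; have f1 := Lfun2_integrable f2.
apply: filterS (resample_integrable i f1) => y igy.
rewrite integralB_EFin//.
rewrite EFinB /resample unlock !fineK//; exact: integrable_fin_num.
Qed.

Lemma variance_resampleE i (f : T -> R) : f \in Lfun nu 2%:E ->
  'V_nu[resample i f] =
  \int[nu]_y ((fine 'E_nu[f] - resample i f y) ^+ 2)%:E.
Proof.
move=> f2; rewrite /variance covariance.unlock expectation_resample//.
rewrite [in LHS]expectation.unlock; apply: eq_integral => y _.
by rewrite -sqrrN opprB expectation.unlock.
Qed.

Lemma variance_resample i (f : T -> R) : f \in Lfun nu 2%:E ->
  'V_nu[resample i f] =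
  \int[nu]_y (\int[nu]_y' (f y' - f (S i (y, y')))%:E) ^+ 2.
Proof.
move=> f2; rewrite variance_resampleE//; apply: ae_eq_integral => //.
- apply/measurable_EFinP; apply: measurable_funX; apply: measurable_funB => //.
  exact/measurable_resample/Lfun2_measurable.
- suff mint : measurable_fun [set: T]
      (fun y => \int[nu]_y' (f y' - f (S i (y, y')))%:E).
    exact: (emeasurable_funM mint mint).
  apply: (@measurable_integral_snd _ _ _ _ _ nu
    (fun z => (f z.2 - f (S i z))%:E)).
  by apply/measurable_EFinP; apply: measurable_funB;
    apply: measurableT_comp => //; exact: Lfun2_measurable.
- by apply: filterS (resample_centered i f2) => y -> _; rewrite EFin_expe.
Qed.

End resampling.

(** * Almost sure uniqueness of conditional expectations *)

Section cond_expectation_uniqueness.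
Context d (T : measurableType d) (R : realType) (P : probability T R).
Context d' (T' : measurableType d') (X : {RV P >-> T'}).
Local Open Scope ereal_scope.

Lemma measurable_g_sigma_algebra_preimage (A : set T) :
  g_sigma_algebra_preimage X A -> measurable A.
Proof. by move=> [B mB <-]; rewrite setTI; exact: measurable_funPTI. Qed.

(** The set where [Y2 < Y1] belongs to the sigma-algebra of [X], so [Y1] and [Y2] have the same
    integral over it. As [Y1 - Y2] is positive there, the set is null. *)
Lemma is_cond_expectation_le (Z Y1 Y2 : T -> R) :
  is_cond_expectation X Z Y1 -> is_cond_expectation X Z Y2 ->
  {ae P, forall w, (Y1 w <= Y2 w)%R}.
Proof.
move=> [m1 i1 e1] [m2 i2 e2]; pose A := [set w | (Y2 w < Y1 w)%R].
have XA : g_sigma_algebra_preimage X A.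
  have /(_ measurableT [set true]) := measurable_fun_ltr m2 m1.
  by rewrite setTI; apply.
have mA := measurable_g_sigma_algebra_preimage XA.
have i1A := integrableS measurableT mA (@subsetT _ A) i1.
have i2A := integrableS measurableT mA (@subsetT _ A) i2.
have mY : measurable_fun A (fun w => (Y1 w - Y2 w)%:E).
  exact: (measurable_int _ (integrableB mA i1A i2A)).
have : \int[P]_(w in A) `|(Y1 w - Y2 w)%:E| = 0.
  transitivity (\int[P]_(w in A) (Y1 w - Y2 w)%:E).
    apply: eq_integral => w /[!inE] Aw.
    by rewrite gee0_abs// lee_fin subr_ge0 ltW.
  rewrite integralB_EFin// e1// e2// subee//.
  by rewrite -e2//; exact: integrable_fin_num.
move/(ae_eq_integral_abs _ mA mY); apply: filterS => w /= Aw0.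
rewrite leNgt; apply/negP => /[dup] Aw /Aw0 -[/eqP].
by rewrite subr_eq0 => /eqP Y12; move: Aw; rewrite Y12 ltxx.
Qed.

Lemma is_cond_expectation_unique (Z Y1 Y2 : T -> R) :
  is_cond_expectation X Z Y1 -> is_cond_expectation X Z Y2 ->
  {ae P, forall w, Y1 w = Y2 w}.
Proof.
move=> Y1P Y2P.
apply: filterS2 (is_cond_expectation_le Y1P Y2P)
  (is_cond_expectation_le Y2P Y1P) => w Y12 Y21.
by apply/le_anti; rewrite Y12 Y21.
Qed.

Lemma is_cond_expectation_comp (Z : T -> R) (g : T' -> R) :
  measurable_fun [set: T'] g -> P.-integrable [set: T] (EFin \o (g \o X)) ->
  (forall B, measurable B ->
    \int[P]_(w in X @^-1` B) (g (X w))%:E = \int[P]_(w in X @^-1` B) (Z w)%:E) ->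
  is_cond_expectation X Z (g \o X).
Proof.
move=> mg ig gZ; split => // [_ B mB|_ [B mB <-]]; last by rewrite setTI gZ.
rewrite setTI; exists (g @^-1` B); last by rewrite setTI.
by rewrite -[X in measurable X]setTI; exact: mg.
Qed.

End cond_expectation_uniqueness.

(** * The joint law of the vector and its independent copy *)

Section independent_copy.
Context d (T : measurableType d) (R : realType) (P : probability T R).
Context d' (T' : measurableType d') (X X' : {RV P >-> T'}).
Hypothesis copyX : independent_copy X' X.
Local Open Scope ereal_scope.
Let nu := distribution P X.

Lemma measurable_fun_copy : measurable_fun [set: T] (fun w => (X w, X' w)).
Proof. exact: measurable_fun_pair. Qed.

(** Independence gives the product formula on rectangles, equality of laws makes both factors [nu],
    and rectangles determine the product measure. *)
Lemma distribution_copy (A : set (T' * T')) : measurable A ->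
  P ((fun w => (X w, X' w)) @^-1` A) = (nu \x nu) A.
Proof.
move=> mA; have [indep law] := copyX.
pose XX : {mfun T >-> (T' * T')%type} := HB.pack (fun w => (X w, X' w))
  (isMeasurableFun.Build _ _ _ _ _ measurable_fun_copy).
rewrite -[LHS]/(pushforward P XX A); apply/esym.
apply: product_measure_unique mA => B C mB mC.
by rewrite /= /pushforward -[P _]/(P (X @^-1` B `&` X' @^-1` C)) indep//
  -[in RHS](law _ mC).
Qed.

End independent_copy.

Lemma product_measure_snd d1 d2 (T1 : measurableType d1)
    (T2 : measurableType d2) (R : realType)
    (m1 : probability T1 R) (m2 : probability T2 R) (A : set T2) :
  measurable A -> (m1 \x m2)%E (snd @^-1` A) = m2 A.
Proof.
move=> mA; rewrite -[_ @^-1` _]setTX product_measure1E//.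
by rewrite [X in (X * _)%E](_ : _ = 1%E) ?mul1e//; exact: probability_setT.
Qed.

(** * Both inequalities, from resampling applied to the law of [X] *)

Section resampled_coordinates.
Context d (T : measurableType d) (R : realType) (P : probability T R).
Context d' (T' : measurableType d') (n : nat).
Variable X : {RV P >-> n.-tuple T'}.
Hypothesis indepX : mutually_independent
  (fun i => component X i : {RV P >-> T'}).
Variables (f : n.-tuple T' -> R) (mf : measurable_fun [set: _] f).
Hypothesis f2 : ('E_P[fun w => (f (X w) ^+ 2)%R] < +oo)%E.
Local Open Scope ereal_scope.

Let nu : probability (n.-tuple T') R := distribution P X.

Let S (i : 'I_n) (z : n.-tuple T' * n.-tuple T') : n.-tuple T' :=
  subst_at z.2 i (tnth z.1 i).

Let mS i : measurable_fun [set: n.-tuple T' * n.-tuple T'] (S i).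
Proof.
apply: measurable_subst_at => //.
exact: (measurableT_comp (measurable_tnth i)).
Qed.

Let nuS i A : measurable A -> (nu \x nu) (S i @^-1` A) = nu A.
Proof. exact: distribution_subst_at. Qed.

Let S_same i y y' z : S i (S i (y, y'), z) = S i (y, z).
Proof. by rewrite /S/= tnth_subst_at. Qed.

Let S_other i j y y' z : i != j -> S j (S i (y, y'), z) = S j (y', z).
Proof. by move=> ij; rewrite /S/= tnth_subst_at_neq// eq_sym. Qed.

Let nuE A : measurable A -> P (X @^-1` A) = nu A.
Proof. by []. Qed.

Let mX : measurable_fun [set: T] X := measurable_funPT X.

Let Lf2 : f \in Lfun nu 2%:E.
Proof.
apply/Lfun2P; split => //; rewrite (integral_law mX nuE)//.
  by move: f2; rewrite unlock.
by apply/measurable_EFinP; exact: measurable_funX.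
Qed.

Let variance_law : 'V_nu[f] = 'V_P[f \o X].
Proof.
have E : 'E_P[f \o X] = 'E_nu[f].
  by rewrite unlock [RHS](integral_law mX nuE)//; exact/measurable_EFinP.
rewrite /variance covariance.unlock E expectation.unlock.
rewrite (integral_law mX nuE)//.
by apply/measurable_EFinP; apply: measurable_funM; exact: measurable_funB.
Qed.

Let le_variance : \sum_i 'V_nu[resample nu S i f] <= 'V_P[f \o X].
Proof.
rewrite -variance_law.
exact: (sum_variance_resample_le mS nuS S_same S_other).
Qed.

Section copy.
Variable X' : {RV P >-> n.-tuple T'}.
Hypothesis copyX : independent_copy X' X.

(** At [(X w, X' w)] this is [Delta f i (X' w) (X w)]: the first slot holds the vector conditioned
    upon. *)
Let h i (z : n.-tuple T' * n.-tuple T') : R := f z.2 - f (S i z).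

Let mh i : measurable_fun [set: n.-tuple T' * n.-tuple T'] (EFin \o h i).
Proof.
by apply/measurable_EFinP; apply: measurable_funB; exact: measurableT_comp.
Qed.

(** Both [snd] and [S i] carry [nu \x nu] to [nu], so each term inherits the integrability of
    [f]. *)
Let integrable_h i : (nu \x nu).-integrable [set: _] (EFin \o h i).
Proof.
have mEf : measurable_fun [set: _] (EFin \o f) by exact/measurable_EFinP.
have if1 := Lfun2_integrable Lf2.
rewrite (_ : _ \o _ = (EFin \o f \o snd) \- (EFin \o f \o S i))//.
apply: integrableB => //.
  exact/(integrable_law measurable_snd (product_measure_snd nu nu) mEf).
exact/(integrable_law (mS i) (nuS i) mEf).
Qed.

Let integrable_Delta i :
  P.-integrable [set: T] (EFin \o (fun w => Delta f i (X' w) (X w))).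
Proof.
exact: (integrable_law (measurable_fun_copy X X') (distribution_copy copyX)
  (mh i)).1 (integrable_h i).
Qed.

Let g i (y : n.-tuple T') : R := fine 'E_nu[f] - resample nu S i f y.

Let mg i : measurable_fun [set: _] (g i).
Proof. by apply: measurable_funB => //; exact: measurable_resample. Qed.

(** Over the event [X \in B], the integral of [g i \o X] becomes an iterated integral of [h i], then
    by Fubini one over [B] times the whole space, then by the joint law that of [Delta]. *)
Let g_cond i : is_cond_expectation X
  (fun w => Delta f i (X' w) (X w)) (g i \o X).
Proof.
have mEg : measurable_fun [set: _] (EFin \o g i) by exact/measurable_EFinP.
apply: is_cond_expectation_comp => // [|B mB].
  apply/(integrable_law mX nuE mEg)/Lfun2_integrable.
  rewrite (_ : g i = cst (fine 'E_nu[f]) \- resample nu S i f)%R//.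
  rewrite rpredB ?lee1n// => p1; first exact: Lfun_cst.
  exact: (resample_Lfun2 mS nuS).
rewrite -(integral_law mX nuE mB mEg).
transitivity (\int[nu]_(y in B) \int[nu]_y' (h i (y, y'))%:E).
  apply: ae_eq_integral => //.
  - exact: measurable_funTS.
  - apply: measurable_funTS.
    exact: (@measurable_integral_snd _ _ _ _ _ nu (EFin \o h i)).
  - by apply: filterS (resample_centered mS nuS i Lf2) => y ->.
have mBT : measurable (B `*` [set: n.-tuple T']) by exact: measurableX.
transitivity (\int[nu \x nu]_(z in B `*` [set: n.-tuple T']) (h i z)%:E).
  (* Extending the integrands by zero off [B] brings Fubini back to the full product space. *)
  rewrite integral_mkcond [RHS]integral_mkcond -integral12_prod_meas1.
    apply: eq_integral => y _; rewrite patchE; case: ifPn => yB.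
      by apply: eq_integral => y' _; rewrite patchE in_setX yB in_setT.
    rewrite /fubini_F integral0_eq// => y' _.
    by rewrite patchE in_setX (negPf yB).
  apply/(integrable_mkcond (EFin \o h i) mBT).
  exact: (integrableS measurableT mBT (@subsetT _ _) (integrable_h i)).
rewrite (integral_law (measurable_fun_copy X X') (distribution_copy copyX) mBT
  (mh i)).
by rewrite (_ : _ @^-1` _ = X @^-1` B)//; apply/seteqP; split => w //= [].
Qed.

(** The chosen version agrees almost surely with [g i \o X], so each summand equals the variance of
    [resample nu S i f]; the inequality is Bessel's. *)
Lemma variance_cond_Delta_le :
  \sum_(i < n) 'E_P[fun w => (cond_expectation X
    (fun v => Delta f i (X' v) (X v)) w ^+ 2)%R] <= 'V_P[f \o X].
Proof.
apply: le_trans le_variance; apply: lee_sum => i _.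
have cP := cond_expectationP X (integrable_Delta i).
have [_ ic _] := cP.
have -> : 'V_nu[resample nu S i f] = \int[P]_w (g i (X w) ^+ 2)%:E.
  rewrite (variance_resampleE mS nuS)// (integral_law mX nuE)//.
  by apply/measurable_EFinP; apply: measurable_funX; exact: (mg i).
rewrite unlock le_eqVlt; apply/orP; left; apply/eqP; apply: ae_eq_integral => //.
- apply/measurable_EFinP; apply: measurable_funX.
  exact/measurable_EFinP/(measurable_int _ ic).
- apply/measurable_EFinP; apply: measurable_funX.
  exact: (measurableT_comp (mg i) mX).
- by apply: filterS (is_cond_expectation_unique cP (g_cond i)) => w ->.
Qed.

End copy.

(** * Identically distributed components and symmetric [f] *)

Section exchangeable.
Variable mu : probability T' R.
Hypothesis Xmu : forall i, has_law (component X i : {RV P >-> T'}) mu.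
Hypothesis symf : symmetric_fun f.

Let D i x := \int[nu]_y (f y - f (subst_at y i x))%:E.

Let measurable_integrand i x :
  measurable_fun [set: _] (fun y => (f y - f (subst_at y i x))%:E).
Proof.
apply/measurable_EFinP; apply: measurable_funB => //.
by apply: measurableT_comp => //; exact: measurable_subst_at.
Qed.

Let measurable_D i : measurable_fun [set: T'] (D i).
Proof.
apply: (@measurable_integral_snd _ _ _ _ _ nu
  (fun z : T' * n.-tuple T' => (f z.2 - f (subst_at z.2 i z.1))%:E)).
apply/measurable_EFinP; apply: measurable_funB; apply: measurableT_comp => //.
exact: measurable_subst_at.
Qed.

(** The transposition of [i] and [j] preserves [nu], and the symmetry of [f] absorbs it in both
    terms of the integrand. *)
Let D_exchange i j x : D i x = D j x.
Proof.
rewrite /D [RHS](integral_law (measurable_permute (tperm i j))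
  (fun A => distribution_permute indepX (tperm i j) Xmu (A := A)))//.
rewrite preimage_setT; apply: eq_integral => y _.
by rewrite symf tpermC -subst_at_tperm symf.
Qed.

(** The inner integral of [variance_resample] depends on [y] through [tnth y i] alone, and that
    coordinate has law [mu] under [nu]. *)
Let variance_resample_D i :
  'V_nu[resample nu S i f] = \int[mu]_x (D i x) ^+ 2.
Proof.
have nu_mu A : measurable A -> nu ((@tnth n T')^~ i @^-1` A) = mu A.
  exact: Xmu.
rewrite (variance_resample mS nuS)//.
rewrite [RHS](integral_law (measurable_tnth i) nu_mu)//.
exact: (emeasurable_funM (@measurable_D i) (@measurable_D i)).
Qed.

Lemma variance_exchangeable_le (i : 'I_n) :
  n%:R%:E * \int[mu]_x
    ('E_P[fun w => (f (X w) - f (subst_at (X w) i x))%R] ^+ 2) <=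
  'V_P[f \o X].
Proof.
apply: le_trans le_variance.
(* All [n] variances coincide with the one at the given index [i]. *)
rewrite (eq_bigr (fun=> \int[mu]_x (D i x) ^+ 2)); last first.
  move=> j _; rewrite variance_resample_D; apply: eq_integral => x _.
  by rewrite (D_exchange j i).
rewrite sumr_const card_ord mule_natl.
rewrite (eq_integral (fun x => D i x ^+ 2))// => x _.
by rewrite unlock /D (integral_law mX nuE).
Qed.

End exchangeable.

End resampled_coordinates.

Theorem corollary2p4 (R : realType) (n : nat) (n_gt0 : (0 < n)%N)
    (E : ptopologicalType) (polishE : polish R E)
    (d : measure_display) (T : measurableType d) (P : probability T R)
    (X X' : {RV P >-> n.-tuple (borel E)})
    (indepX : mutually_independent
                (fun i => component X i : {RV P >-> borel E}))
    (copyX : independent_copy X' X)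
    (f : n.-tuple (borel E) -> R) (mf : measurable_fun [set: _] f)
    (f2 : ('E_P[fun w => (f (X w) ^+ 2)%R] < +oo)%E) :
  ('V_P[f \o X] >=
     \sum_(i < n)
       'E_P[fun w => (cond_expectation X
                        (fun v => Delta f i (X' v) (X v)) w ^+ 2)%R])%E
  /\
  (forall mu : probability (borel E) R,
    (forall i, has_law (component X i : {RV P >-> borel E}) mu) ->
    symmetric_fun f ->
    ('V_P[f \o X] >=
       n%:R%:E *
       \int[mu]_x
         ('E_P[fun w => (f (X w) -
                         f (subst_at (X w) (Ordinal n_gt0) x))%R] ^+ 2))%E).
Proof.
split; first exact: variance_cond_Delta_le.
move=> mu Xmu symf; exact: variance_exchangeable_le.
Qed.
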